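(* Let $\mathcal M\subset{}^d\mathcal K$ be a maximal isotropic subspace. Then the number of negative eigenvalues of $-\Delta(\mathcal M,\underline a)$, counted with multiplicity, is not bigger than $n_+(\mathcal M)$. If $\mathcal I=\emptyset$, then $-\Delta(\mathcal M)$ has precisely $n_+(\mathcal M)$ negative eigenvalues (counted with multiplicity).
   Context: Let $\mathcal G=(V,\mathcal I,\mathcal E,\partial)$ be a finite connected graph: $V$ a finite set of vertices, $\mathcal I$ a finite set of internal edges, $\mathcal E$ a finite set of external edges; $\partial$ assigns to each $i\in\mathcal I$ an ordered pair $(\partial^-(i),\partial^+(i))$ of (possibly equal) vertices and to each $e\in\mathcal E$ a single vertex $\partial(e)$. Fix lengths $\underline a=\{a_i\}_{i\in\mathcal I}$, $a_i>0$, and set $I_i=[0,a_i]$ for $i\in\mathcal I$, $I_e=[0,\infty)$ for $e\in\mathcal E$. Let $\mathcal H=\bigoplus_{j\in\mathcal E\cup\mathcal I}L^2(I_j)$ and let $\mathcal D$ be the set of $\psi=\{\psi_j\}\in\mathcal H$ with $\psi_j,\psi_j'$ absolutely continuous and $\psi_j''\in L^2(I_j)$. Let $\mathcal K=\mathcal K_{\mathcal E}\oplus\mathcal K^{(-)}_{\mathcal I}\oplus\mathcal K^{(+)}_{\mathcal I}$ with $\mathcal K_{\mathcal E}\cong\mathbb C^{|\mathcal E|}$, $\mathcal K^{(\pm)}_{\mathcal I}\cong\mathbb C^{|\mathcal I|}$, and ${}^d\mathcal K=\mathcal K\oplus\mathcal K$. For $\psi\in\mathcal D$ set $\underline\psi=(\{\psi_e(0)\}_{e\in\mathcal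 E},\{\psi_i(0)\}_{i\in\mathcal I},\{\psi_i(a_i)\}_{i\in\mathcal I})$, $\underline\psi'=(\{\psi_e'(0)\}_{e\in\mathcal E},\{\psi_i'(0)\}_{i\in\mathcal I},\{-\psi_i'(a_i)\}_{i\in\mathcal I})$, $[\psi]=\underline\psi\oplus\underline\psi'\in{}^d\mathcal K$. For linear maps $A,B:\mathcal K\to\mathcal K$ let $\mathcal M(A,B)=\{\chi_1\oplus\chi_2:A\chi_1+B\chi_2=0\}$. A subspace $\mathcal M\subset{}^d\mathcal K$ is maximal isotropic (for the form $\langle\chi,J\chi'\rangle$, $J=\begin{pmatrix}0&\mathbb I\\-\mathbb I&0\end{pmatrix}$) iff $\mathcal M=\mathcal M(A,B)$ for linear $A,B$ such that $(A,B):{}^d\mathcal K\to\mathcal K$ has rank $|\mathcal E|+2|\mathcal I|$ and $AB^\dagger$ is self-adjoint; $\mathcal M(A,B)=\mathcal M(A',B')$ iff $A'=CA,B'=CB$ for some invertible $C$. The Laplace operator $\Delta(\mathcal M,\underline a)$ is the self-adjoint operator $(\Delta\psi)_j=\psi_j''$ with domain $\{\psi\in\mathcal D:[\psi]\in\mathcal M\}$ (i.e. $A\underline\psi+B\underline\psi'=0$); if $\mathcal I=\emptyset$ it is written $\Delta(\mathcal M)$. For $\mathcal M=\mathcal M(A,B)$, $n_+(\mathcal M)$, $n_-(\mathcal M)$, $n_0(\mathcal M)$ denote the numbers of positive, negative and zero eigenvalues (with multiplicity) of the self-adjoint matrix $AB^\dagger$; these do not depend on the choice of $(A,B)$. *)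

(* Defs.v *)
From HB Require Import structures.
From mathcomp Require Import all_boot all_order all_algebra.
From mathcomp Require Import all_classical all_reals all_analysis.
From mathcomp Require Import complex.
Set Implicit Arguments. Unset Strict Implicit. Unset Printing Implicit Defensive.
Import Order.TTheory GRing.Theory Num.Theory.
Local Open Scope classical_set_scope.
Local Open Scope ring_scope.
Local Open Scope complex_scope.

Section Defs.
Variable R : realType.
Local Notation C := R[i].
Local Notation mu := (@lebesgue_measure R).

Definition normsq (z : C) : R := complex.Re z ^+ 2 + complex.Im z ^+ 2.

Definition adjmx m n (M : 'M[C]_(m, n)) : 'M[C]_(n, m) := (map_mx Num.conj M)^T.

Definition IE : set R := `[0, +oo[%classic.
Definition II (a : R) : set R := `[0, a]%classic.

(* f is absolutely continuous on I (an interval containing 0) with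
   derivative g, i.e. f x = f 0 + \int_0^x g for all x in I, g locally
   integrable on I. *)
Definition is_primR (I : set R) (f g : R -> R) : Prop :=
  forall x, I x ->
    mu.-integrable `[0, x]%classic (fun t => (g t)%:E) /\
    f x = f 0 + Rintegral mu `[0, x]%classic g.

Definition is_prim (I : set R) (f g : R -> C) : Prop :=
  is_primR I (fun t => complex.Re (f t)) (fun t => complex.Re (g t)) /\
  is_primR I (fun t => complex.Im (f t)) (fun t => complex.Im (g t)).

Definition L2 (I : set R) (f : R -> C) : Prop :=
  mu.-integrable I (fun t => (normsq (f t))%:E).

(* f belongs to the Sobolev-type class of D on I, with (AC representatives of)
   first derivative df and (a.e. defined) second derivative ddf *)
Definition in_D (I : set R) (f df ddf : R -> C) : Prop :=
  is_prim I f df /\ is_prim I df ddf /\ L2 I f /\ L2 I ddf.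

(* boundary vector in K = K_E (+) K_I^- (+) K_I^+ *)
Definition bvec nE nI (fe : 'I_nE -> C) (f0 f1 : 'I_nI -> C)
  : 'cV[C]_(nE + nI + nI) :=
  col_mx (col_mx (\col_(i < nE) fe i) (\col_(i < nI) f0 i)) (\col_(i < nI) f1 i).

(* (A,B) define a maximal isotropic subspace M(A,B) *)
Definition maxiso n (A B : 'M[C]_n) : Prop :=
  \rank (row_mx A B) = n /\ adjmx (A *m adjmx B) = A *m adjmx B.

Definition n_plus n (X : 'M[C]_n) (k : nat) : Prop :=
  exists s : seq C,
    char_poly X = \prod_(z <- s) ('X - z%:P) /\ count (fun z => 0 < z) s = k.

(* psi = (psiE, psiI) is an eigenfunction of -Delta(M(A,B), a) for the
   eigenvalue lam, i.e. psi in Dom, -psi'' = lam psi *)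
Definition eigfun nE nI (a : 'I_nI -> R) (A B : 'M[C]_(nE + nI + nI)) (lam : R)
  (psiE : 'I_nE -> R -> C) (psiI : 'I_nI -> R -> C) : Prop :=
  exists (dE ddE : 'I_nE -> R -> C) (dI ddI : 'I_nI -> R -> C),
    (forall e, in_D IE (psiE e) (dE e) (ddE e)) /\
    (forall i, in_D (II (a i)) (psiI i) (dI i) (ddI i)) /\
    A *m bvec (fun e => psiE e 0) (fun i => psiI i 0) (fun i => psiI i (a i))
    + B *m bvec (fun e => dE e 0) (fun i => dI i 0) (fun i => - dI i (a i)) = 0 /\
    (forall e, {ae mu, forall x, IE x -> ddE e x = (- lam)%:C * psiE e x}) /\
    (forall i, {ae mu, forall x, II (a i) x -> ddI i x = (- lam)%:C * psiI i x}).

Definition mult_ge nE nI (a : 'I_nI -> R) (A B : 'M[C]_(nE + nI + nI)) (lam : R)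
  (d : nat) : Prop :=
  exists (psiE : 'I_d -> 'I_nE -> R -> C) (psiI : 'I_d -> 'I_nI -> R -> C),
    (forall k, eigfun a A B lam (psiE k) (psiI k)) /\
    (forall c : 'I_d -> C,
       (forall e x, IE x -> \sum_(k < d) c k * psiE k e x = 0) ->
       (forall i x, II (a i) x -> \sum_(k < d) c k * psiI k i x = 0) ->
       forall k, c k = 0).

Definition neg_eig_config nE nI (a : 'I_nI -> R) (A B : 'M[C]_(nE + nI + nI))
  m (lam : 'I_m -> R) (d : 'I_m -> nat) : Prop :=
  injective lam /\ (forall j, lam j < 0) /\ (forall j, mult_ge a A B (lam j) (d j)).

Definition neg_count_le nE nI (a : 'I_nI -> R) (A B : 'M[C]_(nE + nI + nI))
  (N : nat) : Prop :=
  forall m (lam : 'I_m -> R) (d : 'I_m -> nat),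
    neg_eig_config a A B lam d -> (\sum_(j < m) d j <= N)%N.

Definition neg_count_eq nE nI (a : 'I_nI -> R) (A B : 'M[C]_(nE + nI + nI))
  (N : nat) : Prop :=
  neg_count_le a A B N /\
  exists m (lam : 'I_m -> R) (d : 'I_m -> nat),
    neg_eig_config a A B lam d /\ (\sum_(j < m) d j)%N = N.

End Defs.

(* Main.v *)
(* Write an element of M(A,B) as (-B^* eta, A^* eta): the boundary form
   <psi, psi'> then equals -<eta, A B^* eta>.  On a combination
   psi = \sum_j psi_j of eigenfunctions for the eigenvalues -kappa_j^2, every
   edge carries a primitive ("flux") of |psi'|^2 + \sum_j kappa_j^2 |psi_j|^2
   built from psi, psi' and the Wronskians of the psi_j.  By isotropy of M(A,B)
   the Wronskians cancel in the sum over all endpoints, so the total increment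
   of the flux is -<psi, psi'>.  With more than n_+ eigenfunctions some nonzero
   combination has eta^* A B^* eta <= 0; all fluxes are then constant and
   psi = 0, a contradiction.

   Without internal edges, U = A + iB is invertible and U^-1 (A - iB) is unitary;
   diagonalizing it diagonalizes A and B simultaneously, A V = W diag(al) and
   B V = W diag(be), so that A B^* = W diag(al * conj be) W^*.  Each index with
   al * conj be > 0 gives the eigenfunction exp(- (al / be) x) times the
   corresponding column of V, and there are at least n_+ such indices. *)
Require Import Defs.
From HB Require Import structures.
From mathcomp Require Import all_boot all_order all_algebra.
From mathcomp Require Import all_classical all_reals all_analysis.
From mathcomp Require Import measurable_realfun complex ring lra.
Import Order.TTheory GRing.Theory Num.Theory.
Import numFieldNormedType.Exports.
Set Implicit Arguments.
Unset Strict Implicit.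
Unset Printing Implicit Defensive.
Local Open Scope classical_set_scope.
Local Open Scope ring_scope.
Local Open Scope complex_scope.

(** * The equation p'' = k^2 p in integrated form *)

Lemma is_primR_continuous (R : realType) (L : R) (f g : R -> R) :
  0 <= L -> is_primR `[0, L]%classic f g -> {within `[0, L], continuous f}.
Proof.
move=> L0 H.
have gi : (@lebesgue_measure R).-integrable `[0, L] (EFin \o g).
  by have [|] := H L; rewrite /= ?in_itv /= ?lexx ?L0.
have c := parameterized_integral_continuous L0 gi.
have cc : {within `[0, L], continuous (fun x => f 0 + \int[lebesgue_measure]_(t in `[0, x]) g t)}.
  by move=> y; apply: cvgD; [exact: cvg_cst | exact: c].
apply: subspace_eq_continuous cc => y /set_mem yL.
by rewrite [RHS](proj2 (H _ yL)).
Qed.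

Lemma is_primR_is_derive (R : realType) (L : R) (f g : R -> R) :
  is_primR `[0, L]%classic f g -> {within `[0, L], continuous g} ->
  forall x, x \in `]0, L[ -> is_derive x 1 f (g x).
Proof.
move=> H cg x xL; have := xL; rewrite in_itv /= => /andP[x0 xltL].
have L0 : 0 < L by exact: lt_trans xltL.
have gi : (@lebesgue_measure R).-integrable `[0, L] (EFin \o g).
  by have [|] := H L; rewrite /= ?in_itv /= ?lexx ?ltW.
have cgx : {for x, continuous g}.
  have /(continuous_within_itvP _ L0)[] := cg.
  by move=> + _ _; apply.
have [dF eF] := @continuous_FTC1_closed _ _ _ _ _ xltL gi x0 cgx.
pose F y := f 0 + \int[lebesgue_measure]_(t in `[0, y]) g t.
have dF' : is_derive x 1 F (g x).
  rewrite -[g x]add0r /F; apply: is_deriveD.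
  by apply: (DeriveDef dF); rewrite -derive1E eF.
apply: near_eq_is_derive dF'.
near=> y; rewrite /F [RHS](proj2 (H y _)) //=.
suff : y \in `]0, L[ by apply: subset_itv_oo_cc.
by near: y; exact: near_in_itvoo.
Unshelve. all: by end_near. Qed.

Lemma is_primR_subset (R : realType) (I J : set R) (f g : R -> R) :
  J `<=` I -> is_primR I f g -> is_primR J f g.
Proof. by move=> JI H x /JI; exact: H. Qed.

Lemma ae_imp (R : realType) (P Q : R -> Prop) :
  (forall x, P x -> Q x) ->
  {ae @lebesgue_measure R, forall x, P x} -> {ae @lebesgue_measure R, forall x, Q x}.
Proof.
move=> PQ [N [mN N0 sub]]; exists N; split=> // x /= nQ; apply: sub => /= Px; exact/nQ/PQ.
Qed.

(** The eigenvalue equation gives the second derivative only almost everywhere. Exchanging it for a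
    continuous representative makes the first derivative differentiable in the classical sense. *)
Lemma eq_ae_is_primR (R : realType) (L : R) (f g h : R -> R) :
  {within `[0, L], continuous h} ->
  {ae @lebesgue_measure R, forall x, `[0, L]%classic x -> g x = h x} ->
  is_primR `[0, L]%classic f g -> is_primR `[0, L]%classic f h.
Proof.
move=> ch gh H x xL; have [gi fx] := H x xL.
have xsub : `[0, x] `<=` `[0, L].
  move: xL; rewrite /= in_itv /= => /andP[_ xL] y /=.
  by rewrite !in_itv /= => /andP[-> /le_trans]; apply.
have hi : (@lebesgue_measure R).-integrable `[0, x] (EFin \o h).
  apply: continuous_compact_integrable; first exact: segment_compact.
  exact: continuous_subspaceW ch.
split=> //; rewrite fx; congr (_ + fine _).
apply: ae_eq_integral => //.
- by have /integrableP[] := gi.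
- by have /integrableP[] := hi.
- by apply: ae_imp gh => y /= + /xsub yL => ->.
Qed.

Lemma is_derive_expRM (R : realType) (k x : R) :
  is_derive x 1 (fun y => expR (k * y)) (k * expR (k * x)).
Proof.
have h : is_derive x 1 (fun y : R => k * y) k.
  by rewrite -[X in is_derive _ _ _ X]mulr1; exact: is_deriveZ.
by rewrite mulrC; exact: is_derive1_comp.
Qed.

Lemma continuous_expRM (R : realType) (k : R) : continuous (fun y => expR (k * y)).
Proof.
move=> x; apply/differentiable_continuous/derivable1_diffP.
by have [] := is_derive_expRM k x.
Qed.

Lemma first_order_ode (R : realType) (L k : R) (u : R -> R) : 0 <= L ->
  {within `[0, L], continuous u} ->
  (forall x, x \in `]0, L[ -> is_derive x 1 u (k * u x)) ->
  u L = u 0 * expR (k * L).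
Proof.
rewrite le_eqVlt => /predU1P[<- _ _|L0 cu du].
  by rewrite mulr0 expR0 mulr1.
(* Integrating factor: [v] has zero derivative on the open interval, so the mean value theorem gives
   [v L = v 0]. *)
pose v x := u x * expR (- k * x).
have [x xL|x|c cL] := @MVT R v (fun=> 0) 0 L L0.
- have := is_deriveM (du x xL) (is_derive_expRM (- k) x).
  rewrite (_ : _ + _ = 0) // /GRing.scale /=; ring.
- by apply: cvgM; [exact: cu|apply: continuous_subspaceT => ?; exact: continuous_expRM].
rewrite mul0r => /eqP; rewrite subr_eq0 /v mulr0 expR0 mulr1 => /eqP <-.
by rewrite -mulrA -expRD mulNr addNr expR0 mulr1.
Qed.

(** The operator factors as (d/dx - k)(d/dx + k): for [s = k] and [s = - k], the function
    [dp + s * p] solves u' = s u. Both [p] and [dp] are recovered linearly from these two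
    solutions. *)
Lemma second_order_ode (R : realType) (I : set R) (k : R) (p dp ddp : R -> R) :
  k != 0 -> I 0 -> (forall x, I x -> 0 <= x /\ `[0, x]%classic `<=` I) ->
  is_primR I p dp -> is_primR I dp ddp ->
  {ae @lebesgue_measure R, forall x, I x -> ddp x = k ^+ 2 * p x} ->
  exists al be : R, forall x, I x ->
    p x = al * expR (k * x) + be * expR (- k * x) /\
    dp x = k * al * expR (k * x) - k * be * expR (- k * x).
Proof.
move=> k0 I0 Isub pdp dpddp aep.
(* The solution of [al + be = p 0] and [k * (al - be) = dp 0]. *)
exists ((dp 0 + k * p 0) / (2 * k)), (- (dp 0 - k * p 0) / (2 * k)) => x Ix.
have [x0 xI] := Isub x Ix.
have {}pdp := is_primR_subset xI pdp.
have {}dpddp := is_primR_subset xI dpddp.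
have cp := is_primR_continuous x0 pdp.
have ckp : {within `[0, x], continuous (fun y => k ^+ 2 * p y)}.
  by move=> y; apply: cvgM; [exact: cvg_cst|exact: cp].
have {}dpddp : is_primR `[0, x]%classic dp (fun y => k ^+ 2 * p y).
  by apply: eq_ae_is_primR dpddp => //; apply: ae_imp aep => y + /xI Iy; exact.
have cdp := is_primR_continuous x0 dpddp.
have Dp := is_primR_is_derive pdp cdp.
have Ddp := is_primR_is_derive dpddp ckp.
have H s : s ^+ 2 = k ^+ 2 -> dp x + s * p x = (dp 0 + s * p 0) * expR (s * x).
  move=> sk; apply: (@first_order_ode R x s (fun y => dp y + s * p y) x0).
    by move=> y; apply: cvgD; [exact: cdp|apply: cvgM; [exact: cvg_cst|exact: cp]].
  move=> y yx; rewrite mulrDr mulrA -expr2 sk [X in is_derive _ _ _ X]addrC.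
  by apply: is_deriveD; [exact: Ddp|apply: is_deriveZ; exact: Dp].
have H1 := H k erefl; have H2 := H (- k) (sqrrN _).
set E := expR (k * x) in H1 *; set F := expR (- k * x) in H2 *.
have pe : p x = (dp x + k * p x - (dp x + - k * p x)) / (2 * k) by field.
have de : dp x = (dp x + k * p x + (dp x + - k * p x)) / 2 by field.
split; [rewrite pe|rewrite de]; rewrite H1 H2; by field.
Qed.

(** * Monotone flux along an edge *)

(** If [al] were nonzero, the growing exponential would force [1 <= n] on a half-line, which has
    infinite measure. A majorant [n] is used so that one integrable squared modulus serves for both
    the real and the imaginary part. *)
Lemma integrable_exp_growth (R : realType) (k al be : R) (n : R -> R) :
  0 < k -> (@lebesgue_measure R).-integrable (@IE R) (fun x => (n x)%:E) ->
  (forall x : R, 0 <= x -> (al * expR (k * x) + be * expR (- k * x)) ^+ 2 <= n x) ->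
  al = 0.
Proof.
move=> k0 ni H; apply/eqP/negPn/negP => al0.
have nal : 0 < `|al| by rewrite normr_gt0.
(* Beyond [x0] one has [|al| * k * x >= 1 + |be|], and [expR (k * x)] exceeds [k * x]; the decaying
   term stays below [|be|], so the sum has modulus at least 1. *)
pose x0 := (1 + `|be|) / (`|al| * k).
have x0ge : 0 <= x0 by rewrite divr_ge0 ?addr_ge0 ?mulr_ge0 // ltW.
have n1 x : x0 <= x -> 1 <= n x.
  move=> x0x; have xge := le_trans x0ge x0x; apply: le_trans (H x xge).
  have e1 : `|be * expR (- k * x)| <= `|be|.
    rewrite normrM [`|expR _|]ger0_norm ?expR_ge0 // ler_piMr // -expR0 ler_expR.
    by rewrite mulNr oppr_le0 mulr_ge0 // ltW.
  have e2 : 1 + `|be| <= `|al * expR (k * x)|.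
    rewrite normrM [`|expR _|]ger0_norm ?expR_ge0 //.
    apply: (@le_trans _ _ (`|al| * (k * x))).
      by move: x0x; rewrite /x0 ler_pdivrMr ?mulr_gt0 // mulrC mulrA.
    rewrite ler_wpM2l //; apply: le_trans (expR_ge1Dx _); lra.
  have e3 : 1 <= `|al * expR (k * x) + be * expR (- k * x)|.
    have := lerB_normD (al * expR (k * x)) (be * expR (- k * x)); lra.
  by rewrite -real_normK ?num_real // exprn_ege1.
have sub : `[x0, +oo[ `<=` @IE R.
  by move=> x; rewrite /IE /= !in_itv /= !andbT; exact: le_trans x0ge.
have ni' : (@lebesgue_measure R).-integrable `[x0, +oo[ (fun x => (n x)%:E).
  apply: integrableS ni; [exact: measurable_itv|exact: measurable_itv|exact: sub].
have /integrableP[mn] := ni'.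
apply/negP; rewrite -leNgt.
have <- : (\int[@lebesgue_measure R]_(x in `[x0, +oo[) cst 1%:E x)%E = +oo%E.
  by rewrite integral_cst //= lebesgue_measure_itv /= ltry mul1e.
apply: ge0_le_integral => //.
- by have /integrableP[] := integrable_abse ni'.
- move=> x; rewrite /= ?in_itv /= andbT => /n1 xn.
  by rewrite lee_fin ger0_norm //; exact: le_trans xn.
Qed.

Section flux.
Variables (R : realType) (m : nat) (mu : 'I_m -> R).

(* On the diagonal the weight is [mu j / 0 = 0]. *)
Definition wt (j k : 'I_m) : R := mu k / (mu k - mu j).

(* Chosen so that, for [p_j'' = mu_j p_j], its derivative is
   [(\sum_j p_j')^2 + \sum_j mu_j p_j^2]: the Wronskians absorb the cross terms
   of [p p''], where [p = \sum_j p_j]. *)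
Definition flux (p dp : 'I_m -> R) : R :=
  \sum_j \sum_k (p j * dp k - wt j k * (p j * dp k - dp j * p k)).

Hypothesis mu_inj : injective mu.

Lemma wtE j k : wt j k * (mu k - mu j) = if j == k then 0 else mu k.
Proof.
rewrite /wt; case: eqP => [->|/eqP jk]; first by rewrite subrr mulr0.
by rewrite divfK // subr_eq0 (inj_eq mu_inj) eq_sym.
Qed.

(** The product [p j * dp k] contributes [dp j * dp k + mu k * p j * p k], and the Wronskian of
    [p j] and [p k] has derivative [(mu k - mu j) * p j * p k]. The weight makes the latter cancel
    the terms [mu k * p j * p k] with j different from k, so only the diagonal ones remain. *)
Lemma is_derive_flux (p dp : 'I_m -> R -> R) (x : R) :
  (forall j, is_derive x 1 (p j) (dp j x)) ->
  (forall j, is_derive x 1 (dp j) (mu j * p j x)) ->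
  is_derive x 1 (fun y => flux (p^~ y) (dp^~ y))
    ((\sum_j dp j x) ^+ 2 + \sum_j mu j * p j x ^+ 2).
Proof.
move=> Dp Ddp.
have -> : (fun y => flux (p^~ y) (dp^~ y)) =
  \sum_j \sum_k (p j * dp k - wt j k *: (p j * dp k - dp j * p k)).
  by apply/funext => y; rewrite fct_sumE; apply: eq_bigr => j _; rewrite fct_sumE.
have D j k := is_deriveB (is_deriveM (Dp j) (Ddp k))
  (is_deriveZ (wt j k) (is_deriveB (is_deriveM (Dp j) (Ddp k)) (is_deriveM (Ddp j) (Dp k)))).
have := is_derive_sum (fun j => is_derive_sum (D j)).
move=> /is_derive_eq; apply.
rewrite expr2 mulr_suml -big_split; apply: eq_bigr => j _ /=.
have -> : mu j * p j x ^+ 2 = \sum_k (if j == k then mu k * p j x * p k x else 0).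
  by rewrite -big_mkcond /= (big_pred1 j) => [|i]; rewrite ?expr2 ?mulrA //= eq_sym.
rewrite mulr_sumr -big_split; apply: eq_bigr => k _ /=; rewrite /GRing.scale /=.
transitivity (dp j x * dp k x + mu k * (p j x * p k x) -
  wt j k * (mu k - mu j) * (p j x * p k x)); first by ring.
by rewrite wtE; case: eqP => _; ring.
Qed.

End flux.

(** At a zero z, multiplying by [expR (k * z)] gives [be = - al * expR (k * z) ^+ 2]. Two distinct
    zeros contradict the strict growth of the exponential unless [al = 0]. *)
Lemma exp_comb_eq0 (R : realType) (k al be x y : R) : 0 < k -> x < y ->
  al * expR (k * x) + be * expR (- k * x) = 0 ->
  al * expR (k * y) + be * expR (- k * y) = 0 -> al = 0 /\ be = 0.
Proof.
move=> k0 xy ex ey.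
have E z : expR (- k * z) * expR (k * z) = 1 by rewrite -expRD mulNr addNr expR0.
have H z : al * expR (k * z) + be * expR (- k * z) = 0 -> be = - al * expR (k * z) ^+ 2.
  move=> e; have := E z; set u := expR (k * z) in e *; set v := expR _ in e *.
  move=> vu; have : (al * u + be * v) * u = 0 by rewrite e mul0r.
  rewrite mulrDl -[be * v * u]mulrA vu mulr1 => /eqP; rewrite addrC addr_eq0 => /eqP ->.
  by ring.
have : al * (expR (k * y) ^+ 2 - expR (k * x) ^+ 2) = 0.
  by rewrite mulrBr -[al * _ as X in X - _]opprK -mulNr -(H y ey) {1}(H x ex); ring.
have exy : expR (k * x) < expR (k * y) by rewrite ltr_expR ltr_pM2l.
move=> /eqP; rewrite mulf_eq0 subr_eq0 => /orP[/eqP al0|].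
  by split=> //; rewrite (H x ex) al0 oppr0 mul0r.
by rewrite gt_eqF // ltr_pXn2r // nnegrE expR_ge0.
Qed.

Lemma cvgy_sum0 (R : realType) (I : finType) (f : I -> R -> R) :
  (forall i, f i x @[x --> +oo] --> (0 : R)) ->
  (\sum_i f i x) @[x --> +oo] --> (0 : R).
Proof.
move=> f0; elim: (index_enum I) => [|i r IHr].
  by under eq_fun do rewrite big_nil; exact: cvg_cst.
under eq_fun do rewrite big_cons.
by have := cvgD (f0 i) IHr; rewrite addr0; apply.
Qed.

Lemma cvgy_mul0 (R : realType) (c : R) (f : R -> R) :
  f x @[x --> +oo] --> (0 : R) -> (c * f x) @[x --> +oo] --> (0 : R).
Proof. by move=> f0; rewrite -(mulr0 c); apply: cvgMl_tmp. Qed.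

Section exponential_flux.
Variables (R : realType) (m : nat) (k al be : 'I_m -> R).
Hypotheses (k_gt0 : forall j, 0 < k j) (k_inj : injective k).

Definition exp_sol (j : 'I_m) (x : R) : R :=
  al j * expR (k j * x) + be j * expR (- k j * x).
Definition dexp_sol (j : 'I_m) (x : R) : R :=
  k j * al j * expR (k j * x) - k j * be j * expR (- k j * x).
Definition exp_flux (x : R) : R :=
  flux (fun j => k j ^+ 2) (exp_sol^~ x) (dexp_sol^~ x).

Lemma is_derive_exp_sol (j : 'I_m) (x : R) : is_derive x 1 (exp_sol j) (dexp_sol j x).
Proof.
have := is_deriveD (is_deriveZ (al j) (is_derive_expRM (k j) x))
  (is_deriveZ (be j) (is_derive_expRM (- k j) x)).
by move=> /is_derive_eq; apply; rewrite /dexp_sol /GRing.scale /=; ring.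
Qed.

Lemma is_derive_dexp_sol (j : 'I_m) (x : R) : is_derive x 1 (dexp_sol j) (k j ^+ 2 * exp_sol j x).
Proof.
have := is_deriveD (is_deriveZ (k j * al j) (is_derive_expRM (k j) x))
  (is_deriveZ (- (k j * be j)) (is_derive_expRM (- k j) x)).
rewrite (_ : _ + _ = dexp_sol j); last first.
  by apply/funext => y; rewrite /dexp_sol -[in RHS]mulNr.
by move=> /is_derive_eq; apply; rewrite /exp_sol /GRing.scale /=; ring.
Qed.

Lemma sqr_inj_gt0 : injective (fun j => k j ^+ 2).
Proof.
move=> i j /eqP; rewrite eqrXn2 // ?ltW // => /eqP; exact: k_inj.
Qed.

Lemma exp_flux_mvt (x y : R) : x < y ->
  exists2 z, x < z < y & exp_flux y - exp_flux x =
   ((\sum_j dexp_sol j z) ^+ 2 + \sum_j k j ^+ 2 * exp_sol j z ^+ 2) * (y - x).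
Proof.
move=> xy.
have D z := is_derive_flux sqr_inj_gt0 (is_derive_exp_sol^~ z) (is_derive_dexp_sol^~ z).
have cF : {within `[x, y], continuous exp_flux}.
  apply: continuous_subspaceT => z.
  by apply/differentiable_continuous/derivable1_diffP; have [] := D z.
have [z zxy e] := MVT xy (fun z _ => D z) cF.
by exists z; first by move: zxy; rewrite in_itv.
Qed.

Lemma exp_flux_le (x y : R) : x < y -> exp_flux x <= exp_flux y.
Proof.
move=> xy; have [z _ e] := exp_flux_mvt xy.
rewrite -subr_ge0 e; apply: mulr_ge0; last by rewrite subr_ge0 ltW.
rewrite addr_ge0 ?sqr_ge0 //.
by apply: sumr_ge0 => j _; rewrite mulr_ge0 ?sqr_ge0.
Qed.

(** By monotonicity the flux takes equal values at [x], at the midpoint and at [y]. On each half the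
    mean value theorem yields a point where the sum of squares vanishes, hence a zero of every
    [exp_sol j]; two zeros are enough. *)
Lemma exp_flux_const (x y : R) : x < y -> exp_flux y <= exp_flux x ->
  forall j, al j = 0 /\ be j = 0.
Proof.
move=> xy yx j; pose c := (x + y) / 2.
have [xc cy] : x < c /\ c < y by rewrite /c; split; lra.
have fxc := exp_flux_le xc; have fcy := exp_flux_le cy.
have Z u v : u < v -> exp_flux v - exp_flux u = 0 ->
    exists2 z, u < z < v & exp_sol j z = 0.
  move=> uv uv0; have [z zuv e] := exp_flux_mvt uv; exists z => //.
  move/eqP: uv0; rewrite e mulf_eq0 [_ - _ == 0]gt_eqF ?subr_gt0 // orbF.
  have S0 : 0 <= \sum_j k j ^+ 2 * exp_sol j z ^+ 2.
    by apply: sumr_ge0 => i _; rewrite mulr_ge0 ?sqr_ge0.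
  rewrite paddr_eq0 ?sqr_ge0 // => /andP[_].
  rewrite psumr_eq0 => [/allP /(_ j)|i _]; last by rewrite mulr_ge0 ?sqr_ge0.
  rewrite mem_index_enum => /(_ isT) /=.
  by rewrite mulf_eq0 !sqrf_eq0 (gt_eqF (k_gt0 j)) => /eqP.
have [|z1 /andP[_ z1c] e1] := Z x c xc; first by lra.
have [|z2 /andP[cz2 _] e2] := Z c y cy; first by lra.
exact: exp_comb_eq0 (k_gt0 j) (lt_trans z1c cz2) e1 e2.
Qed.

(** Without growing exponentials the flux tends to 0 at infinity; being nondecreasing, it is
    nonpositive everywhere. If it is nonnegative at 0, it does not increase on [0, 1]. *)
Lemma exp_flux_decay : (forall j, al j = 0) ->
  exp_flux 0 <= 0 /\ (0 <= exp_flux 0 -> forall j, be j = 0).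
Proof.
move=> al0.
have cE j : expR (- k j * x) @[x --> +oo] --> (0 : R).
  under eq_fun do rewrite mulNr.
  apply: (cvg_comp _ _ _ (@cvgr_expR R)).
  exact: (gt0_cvgMry (k_gt0 j) cvg_id).
have c1 j : exp_sol j x @[x --> +oo] --> (0 : R).
  rewrite /exp_sol al0; under eq_fun do rewrite mul0r add0r.
  exact: cvgy_mul0 (cE j).
have c2 j : dexp_sol j x @[x --> +oo] --> (0 : R).
  rewrite /dexp_sol al0; under eq_fun do rewrite mulr0 mul0r sub0r -mulNr.
  exact: cvgy_mul0 (cE j).
have cF : exp_flux x @[x --> +oo] --> (0 : R).
  apply: cvgy_sum0 => i; apply: cvgy_sum0 => j.
  have c12 u v : exp_sol u x * dexp_sol v x @[x --> +oo] --> (0 : R).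
    by rewrite -(mulr0 (0 : R)); apply: cvgM (c1 u) (c2 v).
  have c21 : dexp_sol i x * exp_sol j x @[x --> +oo] --> (0 : R).
    by under eq_fun do rewrite mulrC; exact: c12.
  have -> : (0 : R) = 0 - wt (fun j => k j ^+ 2) i j * (0 - 0) by ring.
  by apply: cvgB (c12 i j) _; apply: cvgMl_tmp; apply: cvgB (c12 i j) c21.
have le0 x : exp_flux x <= 0.
  apply: cvgr_to_ge cF _; near=> y; apply: exp_flux_le.
  by near: y; apply: nbhs_pinfty_gt; exact: num_real.
split=> [|F0 j]; first exact: le0.
have [//|] := exp_flux_const ltr01 _ j.
exact: le_trans (le0 1) F0.
Unshelve. all: by end_near. Qed.

End exponential_flux.

(** * Maximal isotropic pairs and Hermitian forms *)

Section hermitian_forms.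
Variable R : realType.
Local Notation C := R[i].

Lemma adjmxM m n p (M : 'M[C]_(m, n)) (N : 'M[C]_(n, p)) :
  adjmx (M *m N) = adjmx N *m adjmx M.
Proof. by rewrite /adjmx map_mxM trmx_mul. Qed.

Lemma adjmxN m n (M : 'M[C]_(m, n)) : adjmx (- M) = - adjmx M.
Proof. by rewrite /adjmx map_mxN linearN. Qed.

Lemma adjmxK m n (M : 'M[C]_(m, n)) : adjmx (adjmx M) = M.
Proof. by apply/matrixP => i j; rewrite !mxE conjCK. Qed.

Lemma adjmx_conj m n (M : 'M[C]_(m, n)) : adjmx M = map_mx Num.conj M^T.
Proof. by rewrite /adjmx map_trmx. Qed.

Lemma adjmx_self_eq0 n (v : 'rV[C]_n) : v *m adjmx v = 0 -> v = 0.
Proof.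
move=> /matrixP /(_ 0 0); rewrite !mxE => /eqP.
rewrite psumr_eq0 => [/allP H|i _]; last by rewrite !mxE mul_conjC_ge0.
apply/rowP => i; have := H i (mem_index_enum _).
by rewrite !mxE mul_conjC_eq0 => /eqP.
Qed.

Lemma diag_formE n N (d : 'rV[C]_n) (W : 'M[C]_n) (H : 'M[C]_(n, N)) (c : 'cV[C]_N) :
  (adjmx (H *m c) *m (adjmx W *m diag_mx d *m W) *m (H *m c)) 0 0 =
  \sum_i d 0 i * `|(W *m H *m c) i 0| ^+ 2.
Proof.
rewrite -!mulmxA (mulmxA W) !mulmxA -adjmxM -!mulmxA [W *m _]mulmxA mul_diag_mx mxE.
apply: eq_bigr => i _; rewrite !mxE normCK; ring.
Qed.

(** Killing the coordinates of [W *m H *m c] with positive weight imposes fewer than [N] linear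
    conditions on [c]. The matrix [W] is arbitrary, so that the lemma serves both for unitary
    diagonalizations and for mere congruences. *)
Lemma exists_form_le0 n N (d : 'rV[C]_n) (W : 'M[C]_n) (H : 'M[C]_(n, N)) :
  d \is a mxOver Num.real -> (#|[pred i | (0 < d 0 i)%R]| < N)%N ->
  exists2 c : 'cV[C]_N, c != 0 &
    (adjmx (H *m c) *m (adjmx W *m diag_mx d *m W) *m (H *m c)) 0 0 <= 0.
Proof.
set P := [pred i | _] => /mxOverP d_real PN.
pose K := rowsub (fun l : 'I_#|P| => enum_val l) (W *m H).
(* The columns of [cokermx K] are annihilated by [K], whose rank is at most its number of rows, less
   than [N]. *)
have : cokermx K != 0.
  rewrite cokermx_eq0 /row_full; apply/eqP => KN.
  by move: PN; rewrite -KN ltnNge rank_leq_row.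
case/matrix0Pn => i [j cij]; exists (col j (cokermx K)).
  by apply/matrix0Pn; exists i, 0; rewrite mxE.
rewrite diag_formE; apply: sumr_le0 => l _.
have [lP|lP] := boolP (l \in P).
  have : K *m col j (cokermx K) = 0 by rewrite colE mulmxA mulmx_coker mul0mx.
  move=> /matrixP /(_ (enum_rank_in lP l) 0).
  rewrite /K mul_rowsub_mx !mxE enum_rankK_in // => ->.
  by rewrite normr0 expr0n mulr0.
apply: mulr_le0_ge0; last by rewrite exprn_ge0.
move: lP; rewrite inE -real_leNgt ?real0 //; exact: d_real.
Qed.

Lemma char_poly_similar n (P D : 'M[C]_n) : P \in unitmx ->
  char_poly (invmx P *m D *m P) = char_poly D.
Proof.
move=> Pu; pose Q := map_mx polyC P; pose Q' := map_mx polyC (invmx P).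
have QQ : Q' *m Q = 1%:M by rewrite -map_mxM mulVmx // map_mx1.
rewrite /char_poly (_ : char_poly_mx _ = Q' *m char_poly_mx D *m Q).
  by rewrite !det_mulmx mulrAC -det_mulmx QQ det1 mul1r.
rewrite /char_poly_mx mulmxBr mulmxBl !map_mxM -/Q -/Q'; congr (_ - _).
by rewrite mul_mx_scalar -scalemxAl QQ scalemx1.
Qed.

(** The spectral theorem gives a second factorization of [char_poly X] into linear factors. It
    agrees up to permutation with the root list in [n_plus], so positive entries are counted
    alike. *)
Lemma hermitian_diag n (X : 'M[C]_n) (k : nat) : adjmx X = X -> n_plus X k ->
  exists (P : 'M[C]_n) (d : 'rV[C]_n),
  [/\ P *m adjmx P = 1%:M, X = adjmx P *m diag_mx d *m P,
      d \is a mxOver Num.real & #|[pred i | (0 < d 0 i)%R]| = k].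
Proof.
move=> Xh [s [Xs sk]].
have Xherm : X \is hermsymmx.
  by rewrite is_hermitianmxE expr0 scale1r -adjmx_conj Xh.
have /orthomx_spectralP := hermitian_normalmx Xherm.
set P := spectralmx X; set d := spectral_diag X => XE.
have Pu : P \is unitarymx := spectral_unitarymx X.
exists P, d; split.
- by rewrite adjmx_conj; apply/unitarymxP.
- by rewrite {1}XE invmx_unitary // adjmx_conj.
- exact: hermitian_spectral_diag_real.
rewrite -sk; have : perm_eq s [seq d 0 i | i <- enum 'I_n].
  apply: prod_XsubC_eq; rewrite -Xs XE char_poly_similar ?spectral_unit //.
  rewrite char_poly_trig ?diag_mx_is_trig // big_map enumT.
  by apply: eq_bigr => i _; rewrite mxE eqxx.
move/permP ->; rewrite -sum1_count big_map enumT -sum1_card.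
by apply: eq_bigl => i; rewrite inE.
Qed.

Lemma maxiso_adj n (A B : 'M[C]_n) : maxiso A B -> B *m adjmx A = A *m adjmx B.
Proof. by case=> _ <-; rewrite adjmxM adjmxK. Qed.

Lemma maxiso_inj n (A B : 'M[C]_n) m (v : 'M[C]_(m, n)) : maxiso A B ->
  v *m A = 0 -> v *m B = 0 -> v = 0.
Proof.
move=> [rk _] vA vB; have /row_freeP[Z MZ] : row_free (row_mx A B) by apply/eqP.
by rewrite -[v]mulmx1 -MZ mulmxA mul_mx_row vA vB row_mx0 mul0mx.
Qed.

(** The pairs on the right lie in M(A,B) because [B *m adjmx A = A *m adjmx B]. They form a space of
    dimension n, which is also the dimension 2n - n of M(A,B). *)
Lemma maxiso_param n (A B : 'M[C]_n) N (x1 x2 : 'M[C]_(n, N)) : maxiso A B ->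
  A *m x1 + B *m x2 = 0 ->
  exists eta : 'M[C]_(n, N), x1 = - (adjmx B *m eta) /\ x2 = adjmx A *m eta.
Proof.
move=> AB x12; pose M := row_mx A B.
(* Everything is transposed, since subspaces are represented by row spaces. *)
pose Z := row_mx (- (adjmx B)^T) (adjmx A)^T.
have Zfree : row_free Z.
  apply: inj_row_free => v; rewrite /Z mul_mx_row -row_mx0 => /eq_row_mx[].
  rewrite mulmxN /adjmx !trmxK => /eqP; rewrite oppr_eq0 => /eqP vB vA.
  (* The blocks of [Z] are, up to sign, the entrywise conjugates of [B] and [A], whereas the rank
     hypothesis is about [A] and [B] themselves; conjugating [v] bridges the two. *)
  have cv D : v *m map_mx Num.conj D = 0 -> map_mx Num.conj v *m D = 0.
    move=> H; have := congr1 (map_mx (Num.conj : C -> C)) H.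
    rewrite map_mxM map_mx0 -map_mx_comp /=.
    by rewrite (_ : map_mx _ D = D) //; apply/matrixP => i j; rewrite mxE /= conjCK.
  have v0 := maxiso_inj AB (cv _ _ vA) (cv _ _ vB).
  by apply/rowP => i; have /rowP/(_ i) := v0; rewrite !mxE => /eqP; rewrite conjC_eq0 => /eqP.
have Zker : (Z <= kermx M^T)%MS.
  apply/sub_kermxP; rewrite /Z /M tr_row_mx mul_row_col mulNmx.
  by rewrite -!trmx_mul (maxiso_adj AB) addNr.
have kerZ : (kermx M^T <= Z)%MS.
  have /leqifP := mxrank_leqif_sup Zker.
  case: ifP => // _; rewrite mxrank_ker mxrank_tr; case: (AB) => -> _.
  by move/eqP: Zfree => ->; rewrite addnK ltnn.
have /submx_trans/(_ kerZ)/submxP[D DE] : ((col_mx x1 x2)^T <= kermx M^T)%MS.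
  by apply/sub_kermxP; rewrite -trmx_mul mul_row_col x12 trmx0.
exists D^T; move: DE; rewrite tr_col_mx mul_mx_row => /eq_row_mx[E1 E2].
by split; apply: trmx_inj; [rewrite E1 mulmxN raddfN|rewrite E2];
  rewrite /= trmx_mul (trmxK D).
Qed.

Lemma maxiso_isotropic n (A B : 'M[C]_n) N (x1 x2 : 'M[C]_(n, N)) :
  maxiso A B -> A *m x1 + B *m x2 = 0 -> adjmx x1 *m x2 = adjmx x2 *m x1.
Proof.
move=> AB /(maxiso_param AB)[eta [-> ->]].
rewrite adjmxN !adjmxM !adjmxK mulNmx mulmxN; congr (- _).
by rewrite !mulmxA -(mulmxA _ B) (maxiso_adj AB) mulmxA.
Qed.

Lemma maxiso_nonneg n (A B : 'M[C]_n) k N (x1 x2 : 'M[C]_(n, N)) :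
  maxiso A B -> n_plus (A *m adjmx B) k -> A *m x1 + B *m x2 = 0 -> (k < N)%N ->
  exists2 c : 'cV[C]_N, c != 0 & 0 <= (adjmx (x1 *m c) *m (x2 *m c)) 0 0.
Proof.
move=> AB ABk /(maxiso_param AB)[eta [-> ->]] kN.
have [P [d [_ XE dr dk]]] := hermitian_diag (proj2 AB) ABk.
have [|c c0 cle] := @exists_form_le0 _ N d P eta dr; first by rewrite dk.
exists c => //; move: cle; rewrite -XE -oppr_ge0.
rewrite mulNmx adjmxN !adjmxM !adjmxK mulNmx !mulmxA -(mulmxA _ B).
by rewrite (maxiso_adj AB) mulmxA [X in _ -> _ <= X]mxE.
Qed.

(** With [U = A + i *: B] and [T = A - i *: B], the cross terms of [U *m adjmx U] and of
    [T *m adjmx T] cancel, so both equal [G]. This makes the Cayley transform [S] unitary, hence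
    unitarily diagonalizable. *)
Lemma maxiso_simdiag n (A B : 'M[C]_n) : maxiso A B ->
  exists (V W : 'M[C]_n) (al be : 'rV[C]_n),
  [/\ V *m adjmx V = 1%:M, W \in unitmx,
      A *m V = W *m diag_mx al & B *m V = W *m diag_mx be].
Proof.
move=> AB; have BA := maxiso_adj AB.
pose i : C := 'i%R; have ii : i * i = -1 by rewrite -expr2 sqrCi.
have ci : Num.conj i = - i by rewrite conjCi.
pose U := A + i *: B; pose T := A - i *: B.
have adjU : adjmx U = adjmx A - i *: adjmx B.
  by apply/matrixP => r s; rewrite !mxE rmorphD rmorphM /= ci mulNr.
have adjT : adjmx T = adjmx A + i *: adjmx B.
  by apply/matrixP => r s; rewrite !mxE rmorphB rmorphM /= ci mulNr opprK.
pose G := A *m adjmx A + B *m adjmx B.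
have UG : U *m adjmx U = G.
  rewrite adjU mulmxBr !mulmxDl -!scalemxAr -!scalemxAl scalerA ii scaleN1r BA.
  by apply/matrixP => r s; rewrite !mxE; ring.
have TG : T *m adjmx T = G.
  rewrite adjT mulmxDr !mulmxBl -!scalemxAr -!scalemxAl scalerA ii scaleN1r BA.
  by apply/matrixP => r s; rewrite !mxE; ring.
have i0 : i != 0 by exact: neq0Ci.
(* If [v *m U = 0], then [v *m T] has norm zero by [TG] and [UG]; so [v] annihilates [U] and [T],
   hence [A] and [B]. *)
have Uu : U \in unitmx.
  rewrite -row_free_unit; apply: inj_row_free => v vU.
  have vT : v *m T = 0.
    apply: adjmx_self_eq0; rewrite adjmxM mulmxA -(mulmxA v) TG -UG.
    by rewrite mulmxA vU !mul0mx.
  apply: (maxiso_inj AB).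
    have -> : A = 2^-1 *: (U + T) by apply/matrixP => r s; rewrite !mxE; field.
    by rewrite -scalemxAr mulmxDr vU vT addr0 scaler0.
  have -> : B = (2 * i)^-1 *: (U - T) by apply/matrixP => r s; rewrite !mxE; field.
  by rewrite -scalemxAr mulmxBr vU vT subr0 scaler0.
pose S := invmx U *m T.
have SU : S \is unitarymx.
  apply/unitarymxP; rewrite -adjmx_conj /S adjmxM mulmxA -(mulmxA _ T) TG -UG.
  by rewrite mulmxA mulVmx // mul1mx -adjmxM mulVmx // /adjmx map_mx1 trmx1.
have /orthomx_spectralP : S \is normalmx.
  apply/normalmxP; have /unitarymxP SS := SU; rewrite SS.
  by rewrite (mulmx1C SS).
set P := spectralmx S; set s := spectral_diag S => SE.
have Pu : P \is unitarymx := spectral_unitarymx S.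
have PP : P *m adjmx P = 1%:M by rewrite adjmx_conj; apply/unitarymxP.
have TV : T *m adjmx P = U *m adjmx P *m diag_mx s.
  rewrite -[T](mulKVmx Uu) -/S {1}SE invmx_unitary // -adjmx_conj.
  by rewrite -!mulmxA PP mulmx1.
(* From [A = (U + T) / 2], [B = (U - T) / (2 * i)], and the fact that [T] acts on the eigenvectors
   of [S] as [U] times the eigenvalue. *)
exists (adjmx P), (U *m adjmx P), (\row_j ((1 + s 0 j) / 2)), (\row_j ((1 - s 0 j) / (2 * i))).
split.
- by rewrite adjmxK; exact: mulmx1C.
- by rewrite unitmx_mul Uu; case/mulmx1_unit: PP.
- have -> : A = 2^-1 *: (U + T) by apply/matrixP => r t; rewrite !mxE; field.
  rewrite -scalemxAl mulmxDl TV !mul_mx_diag; apply/matrixP => r t.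
  by move: (U *m adjmx P) => Y; rewrite !mxE; field.
- have -> : B = (2 * i)^-1 *: (U - T) by apply/matrixP => r t; rewrite !mxE; field.
  rewrite -scalemxAl mulmxBl TV !mul_mx_diag; apply/matrixP => r t.
  by move: (U *m adjmx P) => Y; rewrite !mxE; field.
Qed.

(** The ratio [al / be] is [al * conj be] divided by [|be| ^ 2], so each positive entry of [g] gives
    a positive generalized eigenvalue of the pair. *)
Lemma maxiso_pencil n (A B : 'M[C]_n) (k : nat) :
  maxiso A B -> n_plus (A *m adjmx B) k ->
  exists (V : 'M[C]_n) (kap : 'I_k -> R) (f : 'I_k -> 'I_n),
  [/\ V \in unitmx, injective f, forall l, 0 < kap l &
    forall l, A *m col (f l) V = (kap l)%:C *: (B *m col (f l) V)].
Proof.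
move=> AB ABk; have [V [W [al [be [VV Wu AV BV]]]]] := maxiso_simdiag AB.
have [P [d [PP XE dr dk]]] := hermitian_diag (proj2 AB) ABk.
pose g := \row_j (al 0 j * Num.conj (be 0 j)).
have XW : A *m adjmx B = adjmx (adjmx W) *m diag_mx g *m adjmx W.
  have VV' := mulmx1C VV.
  rewrite -[A]mulmx1 -VV mulmxA AV -!mulmxA -adjmxM BV adjmxM adjmxK.
  rewrite !mulmxA -(mulmxA W); congr (W *m _ *m _).
  rewrite (_ : adjmx (diag_mx be) = diag_mx (map_mx Num.conj be)); last first.
    by rewrite /adjmx map_diag_mx tr_diag_mx.
  by rewrite mulmx_diag; congr diag_mx; apply/rowP => j; rewrite !mxE.
have gr : g \is a mxOver Num.real.
  have gg : diag_mx g = adjmx (diag_mx g).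
    have := proj2 AB; rewrite XW adjmxK !adjmxM !adjmxK mulmxA.
    have Wu' : adjmx W \in unitmx by rewrite unitmx_tr map_unitmx.
    by move=> /(can_inj (mulmxK Wu')) /(can_inj (mulKmx Wu)).
  apply/mxOverP => i j; rewrite ord1; apply/CrealP.
  by move/matrixP: gg => /(_ j j); rewrite !mxE eqxx !mulr1n.
pose Q := [pred i | (0 < g 0 i)%R].
(* One half of Sylvester's law of inertia, needed because [W] is only invertible and [g] need not
   list eigenvalues. Otherwise some nonzero combination of eigenvectors of [A *m adjmx B] with
   positive eigenvalues would make the form nonpositive, while the form is positive definite on
   their span. *)
have kQ : (k <= #|Q|)%N.
  rewrite leqNgt; apply/negP => Qk.
  pose p := [pred i | (0 < d 0 i)%R].
  have [|c c0 cle] := @exists_form_le0 n #|p| g (adjmx W)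
      (colsub (fun l : 'I_#|p| => enum_val l) (adjmx P)) gr; first by rewrite dk.
  case/negP: c0; apply/eqP; move: cle; rewrite -XW XE diag_formE.
  rewrite mulmx_colsub PP => cle.
  set D := colsub _ _ in cle.
  have Dc l : (D *m c) (enum_val l) 0 = c l 0.
    rewrite mxE (bigD1 l) //= !mxE eqxx mul1r big1 ?addr0 // => l' ll'.
    by rewrite !mxE (inj_eq enum_val_inj) eq_sym (negPf ll') mul0r.
  have D0 i : i \notin p -> (D *m c) i 0 = 0.
    move=> ip; rewrite mxE big1 // => l _; rewrite !mxE; case: eqP => [il|_].
      by move: ip; rewrite il enum_valP.
    by rewrite mul0r.
  have ge i : 0 <= d 0 i * `|(D *m c) i 0| ^+ 2.
    have [ip|/D0 ->] := boolP (i \in p); last by rewrite normr0 expr0n mulr0.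
    by rewrite mulr_ge0 ?exprn_ge0 // ltW.
  have s0 : \sum_i d 0 i * `|(D *m c) i 0| ^+ 2 = 0.
    by apply: le_anti; rewrite cle sumr_ge0.
  apply/colP => l; rewrite [RHS]mxE -Dc.
  move/eqP: s0; rewrite psumr_eq0 => [/allP/(_ (enum_val l) (mem_index_enum _))|//].
  have /= lp := enum_valP l.
  by rewrite mulf_eq0 (gt_eqF lp) sqrf_eq0 normr_eq0 => /eqP.
pose f (l : 'I_k) := enum_val (widen_ord kQ l).
have gf l : 0 < g 0 (f l) by exact: (enum_valP (widen_ord kQ l)).
exists V, (fun l => complex.Re (al 0 (f l) / be 0 (f l))), f.
have be0 l : be 0 (f l) != 0.
  by apply/eqP => b0; have := gf l; rewrite mxE b0 conjC0 mulr0 ltxx.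
have kE l : 0 < al 0 (f l) / be 0 (f l).
  have -> : al 0 (f l) / be 0 (f l) = g 0 (f l) / `|be 0 (f l)| ^+ 2.
    by rewrite mxE normCK; field; rewrite be0 conjC_eq0 be0.
  by rewrite divr_gt0 ?exprn_gt0 ?normr_gt0.
split.
- by case/mulmx1_unit: VV.
- by move=> l l' /enum_val_inj/(congr1 val) /= ll'; apply: val_inj.
- by move=> l; have := kE l; rewrite ltcE => /andP[_].
move=> l; have -> : (complex.Re (al 0 (f l) / be 0 (f l)))%:C = al 0 (f l) / be 0 (f l).
  by apply: RRe_real; apply: gtr0_real.
rewrite !colE !mulmxA AV BV -!colE !mul_mx_diag; apply/colP => i.
by rewrite !mxE; field; apply: be0.
Qed.

End hermitian_forms.

(** * Complex solutions on an edge *)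

Section complex_edges.
Variable R : realType.
Local Notation C := R[i].

Lemma conjE (z : C) : Num.conj z = (complex.Re z -i* complex.Im z).
Proof. by case: z. Qed.

Lemma ReD (y z : C) : complex.Re (y + z) = complex.Re y + complex.Re z.
Proof. by case: y z => ? ? []. Qed.
Lemma ImD (y z : C) : complex.Im (y + z) = complex.Im y + complex.Im z.
Proof. by case: y z => ? ? []. Qed.
Lemma ReN (z : C) : complex.Re (- z) = - complex.Re z.
Proof. by case: z. Qed.
Lemma ImN (z : C) : complex.Im (- z) = - complex.Im z.
Proof. by case: z. Qed.
Lemma Re_mulrc (z : C) (r : R) : complex.Re (z * r%:C) = complex.Re z * r.
Proof. by case: z => u v /=; rewrite mulr0 subr0. Qed.
Lemma Im_mulrc (z : C) (r : R) : complex.Im (z * r%:C) = complex.Im z * r.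
Proof. by case: z => u v /=; rewrite mulr0 add0r. Qed.
Lemma Re_sum (I : finType) (f : I -> C) :
  complex.Re (\sum_i f i) = \sum_i complex.Re (f i).
Proof. exact: (big_morph _ ReD). Qed.
Lemma eq_complexP (y z : C) :
  complex.Re y = complex.Re z -> complex.Im y = complex.Im z -> y = z.
Proof. by case: y z => ? ? [? ?] /= -> ->. Qed.

Definition cexp (al be : C) (k x : R) : C :=
  al * (expR (k * x))%:C + be * (expR (- k * x))%:C.
Definition dcexp (al be : C) (k x : R) : C :=
  (al * k%:C) * (expR (k * x))%:C - (be * k%:C) * (expR (- k * x))%:C.

Lemma Re_cexp al be k x : complex.Re (cexp al be k x) =
  complex.Re al * expR (k * x) + complex.Re be * expR (- k * x).
Proof. by rewrite /cexp ReD !Re_mulrc. Qed.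
Lemma Im_cexp al be k x : complex.Im (cexp al be k x) =
  complex.Im al * expR (k * x) + complex.Im be * expR (- k * x).
Proof. by rewrite /cexp ImD !Im_mulrc. Qed.
Lemma Re_dcexp al be k x : complex.Re (dcexp al be k x) =
  k * complex.Re al * expR (k * x) - k * complex.Re be * expR (- k * x).
Proof. by rewrite /dcexp ReD ReN !Re_mulrc; ring. Qed.
Lemma Im_dcexp al be k x : complex.Im (dcexp al be k x) =
  k * complex.Im al * expR (k * x) - k * complex.Im be * expR (- k * x).
Proof. by rewrite /dcexp ImD ImN !Im_mulrc; ring. Qed.

Lemma eigen_edge (I : set R) (k : R) (f df ddf : R -> C) :
  k != 0 -> I 0 -> (forall x, I x -> 0 <= x /\ `[0, x]%classic `<=` I) ->
  is_prim I f df -> is_prim I df ddf ->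
  {ae @lebesgue_measure R, forall x, I x -> ddf x = (k ^+ 2)%:C * f x} ->
  exists al be : C, forall x, I x -> f x = cexp al be k x /\ df x = dcexp al be k x.
Proof.
move=> k0 I0 Isub [fR fI] [dfR dfI] aef.
have aeR : {ae @lebesgue_measure R, forall x, I x ->
    complex.Re (ddf x) = k ^+ 2 * complex.Re (f x)}.
  by apply: ae_imp aef => x + Ix => /(_ Ix) ->; rewrite mulrC Re_mulrc mulrC.
have aeI : {ae @lebesgue_measure R, forall x, I x ->
    complex.Im (ddf x) = k ^+ 2 * complex.Im (f x)}.
  by apply: ae_imp aef => x + Ix => /(_ Ix) ->; rewrite mulrC Im_mulrc mulrC.
have [ar [br Hr]] := second_order_ode k0 I0 Isub fR dfR aeR.
have [ai [bi Hi]] := second_order_ode k0 I0 Isub fI dfI aeI.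
exists (ar +i* ai), (br +i* bi) => x Ix.
have [Hr1 Hr2] := Hr x Ix; have [Hi1 Hi2] := Hi x Ix.
split; apply: eq_complexP.
- by rewrite Re_cexp.
- by rewrite Im_cexp.
- by rewrite Re_dcexp.
- by rewrite Im_dcexp.
Qed.

Lemma L2_cexp (k : R) (al be : C) (f : R -> C) : 0 < k -> L2 (@IE R) f ->
  (forall x, @IE R x -> f x = cexp al be k x) -> al = 0.
Proof.
move=> k0 fL2 fE.
have H x : 0 <= x -> f x = cexp al be k x.
  by move=> x0; apply: fE; rewrite /IE /= in_itv /= x0.
apply: eq_complexP.
- apply: (integrable_exp_growth k0 fL2 (be := complex.Re be)) => x x0.
  by rewrite /normsq H // -Re_cexp lerDl sqr_ge0.
- apply: (integrable_exp_growth k0 fL2 (be := complex.Im be)) => x x0.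
  by rewrite /normsq H // -Im_cexp lerDr sqr_ge0.
Qed.

Section cflux.
Variables (m : nat) (k : 'I_m -> R).
Let mu (j : 'I_m) := k j ^+ 2.

(** Sesquilinear counterpart of [flux]; the conjugate stands on the first factor so that sums over
    endpoints become entries of [adjmx y1 *m y2]. *)
Definition cflux (u du : 'I_m -> C) : C :=
  \sum_j \sum_l (Num.conj (u j) * du l -
    (wt mu j l)%:C * (Num.conj (u j) * du l - Num.conj (du j) * u l)).

Lemma Re_cflux u du : complex.Re (cflux u du) =
  flux mu (fun j => complex.Re (u j)) (fun j => complex.Re (du j)) +
  flux mu (fun j => complex.Im (u j)) (fun j => complex.Im (du j)).
Proof.
rewrite /cflux /flux Re_sum -big_split; apply: eq_bigr => j _ /=.
rewrite Re_sum -big_split; apply: eq_bigr => l _ /=.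
rewrite ReD ReN [(wt _ _ _)%:C * _]mulrC Re_mulrc !conjE.
by case: (u j) (du l) (du j) (u l) => ? ? [? ?] [? ?] [? ?] /=; ring.
Qed.

Lemma cfluxN u du : cflux u (fun j => - du j) = - cflux u du.
Proof.
rewrite /cflux -sumrN; apply: eq_bigr => j _; rewrite -sumrN; apply: eq_bigr => l _.
rewrite rmorphN /=; ring.
Qed.

(** For each pair of indices the weight does not depend on the endpoint [r], so it multiplies an
    entry of [adjmx y1 *m y2 - adjmx y2 *m y1], which is zero. *)
Lemma sum_cflux n (y1 y2 : 'M[C]_(n, m)) : adjmx y1 *m y2 = adjmx y2 *m y1 ->
  \sum_r cflux (y1 r) (y2 r) = \sum_j \sum_l (adjmx y1 *m y2) j l.
Proof.
move=> iso; rewrite /cflux exchange_big; apply: eq_bigr => j _ /=.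
rewrite exchange_big; apply: eq_bigr => l _ /=.
have E (z1 z2 : 'M[C]_(n, m)) :
    \sum_r Num.conj (z1 r j) * z2 r l = (adjmx z1 *m z2) j l.
  by rewrite mxE; apply: eq_bigr => r _; rewrite !mxE.
by rewrite sumrB -mulr_sumr sumrB !E iso subrr mulr0 subr0.
Qed.

Hypotheses (k_gt0 : forall j, 0 < k j) (k_inj : injective k).

Lemma Re_cflux_cexp (al be : 'I_m -> C) x :
  complex.Re (cflux (fun j => cexp (al j) (be j) (k j) x)
                    (fun j => dcexp (al j) (be j) (k j) x)) =
  exp_flux k (fun j => complex.Re (al j)) (fun j => complex.Re (be j)) x +
  exp_flux k (fun j => complex.Im (al j)) (fun j => complex.Im (be j)) x.
Proof.
rewrite Re_cflux /exp_flux; congr (_ + _); congr flux; apply/funext => j;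
  by rewrite ?Re_cexp ?Im_cexp ?Re_dcexp ?Im_dcexp.
Qed.

Lemma cflux_internal (al be : 'I_m -> C) (a : R) : 0 < a ->
  let F x := complex.Re (cflux (fun j => cexp (al j) (be j) (k j) x)
                    (fun j => dcexp (al j) (be j) (k j) x)) in
  F 0 <= F a /\ (F a <= F 0 -> forall j, al j = 0 /\ be j = 0).
Proof.
move=> a0 /=; rewrite !Re_cflux_cexp.
set alr := fun j => complex.Re (al j); set ber := fun j => complex.Re (be j).
set ali := fun j => complex.Im (al j); set bei := fun j => complex.Im (be j).
have hr := exp_flux_le alr ber k_gt0 k_inj a0.
have hi := exp_flux_le ali bei k_gt0 k_inj a0.
split=> [|h j]; first exact: lerD.
have [|r1 r2] := exp_flux_const k_gt0 k_inj (al := alr) (be := ber) a0 _ j; first lra.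
have [|i1 i2] := exp_flux_const k_gt0 k_inj (al := ali) (be := bei) a0 _ j; first lra.
by split; apply: eq_complexP.
Qed.

Lemma cflux_external (be : 'I_m -> C) :
  let F := complex.Re (cflux (fun j => cexp 0 (be j) (k j) 0)
                    (fun j => dcexp 0 (be j) (k j) 0)) in
  F <= 0 /\ (0 <= F -> forall j, be j = 0).
Proof.
rewrite (Re_cflux_cexp (fun=> 0)) /=.
set ber := fun j => complex.Re (be j); set bei := fun j => complex.Im (be j).
have [hr hr'] := exp_flux_decay (al := fun=> 0) ber k_gt0 k_inj (fun=> erefl).
have [hi hi'] := exp_flux_decay (al := fun=> 0) bei k_gt0 k_inj (fun=> erefl).
split=> [|h j]; first by rewrite -[leRHS]addr0; exact: lerD.
by apply: eq_complexP; [apply: hr'|apply: hi']; lra.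
Qed.

End cflux.
End complex_edges.

(** * Boundary values on the graph *)

Section graph.
Variables (R : realType) (nE nI : nat) (a : 'I_nI -> R).
Local Notation C := R[i].
Variables A B : 'M[C]_(nE + nI + nI).

Lemma bvec_ext (fe : 'I_nE -> C) (f0 f1 : 'I_nI -> C) e :
  bvec fe f0 f1 (lshift _ (lshift _ e)) 0 = fe e.
Proof. by rewrite /bvec !col_mxEu mxE. Qed.
Lemma bvec_int0 (fe : 'I_nE -> C) (f0 f1 : 'I_nI -> C) i :
  bvec fe f0 f1 (lshift _ (rshift _ i)) 0 = f0 i.
Proof. by rewrite /bvec col_mxEu col_mxEd mxE. Qed.
Lemma bvec_int1 (fe : 'I_nE -> C) (f0 f1 : 'I_nI -> C) i :
  bvec fe f0 f1 (rshift _ i) 0 = f1 i.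
Proof. by rewrite /bvec col_mxEd mxE. Qed.
Definition bvecE := (bvec_ext, bvec_int0, bvec_int1).

Lemma forall_bindex (P : 'I_(nE + nI + nI) -> Prop) :
  (forall e, P (lshift _ (lshift _ e))) ->
  (forall i, P (lshift _ (rshift _ i))) -> (forall i, P (rshift _ i)) ->
  forall r, P r.
Proof.
move=> Pe P0 P1 r; case: (split_ordP r) => s ->; last exact: P1.
by case: (split_ordP s) => t ->.
Qed.

(** Rows are endpoints and columns are functions: a row is an argument of [cflux], and right
    multiplication forms linear combinations of the functions. *)
Definition bmx m (fe : 'I_nE -> 'I_m -> C) (f0 f1 : 'I_nI -> 'I_m -> C) :
    'M[C]_(nE + nI + nI, m) :=
  \matrix_(r, j) bvec (fe^~ j) (f0^~ j) (f1^~ j) r 0.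

Lemma col_bmx m (fe : 'I_nE -> 'I_m -> C) (f0 f1 : 'I_nI -> 'I_m -> C) j :
  col j (bmx fe f0 f1) = bvec (fe^~ j) (f0^~ j) (f1^~ j).
Proof. by apply/colP => r; rewrite [LHS]mxE [LHS]mxE. Qed.

Lemma mul_bmx m p (fe : 'I_nE -> 'I_m -> C) (f0 f1 : 'I_nI -> 'I_m -> C)
    (E : 'M[C]_(m, p)) :
  bmx fe f0 f1 *m E = bmx (fun e j => \sum_l fe e l * E l j)
    (fun i j => \sum_l f0 i l * E l j) (fun i j => \sum_l f1 i l * E l j).
Proof.
apply/matrixP => r j; rewrite [LHS]mxE [RHS]mxE.
by elim/forall_bindex: r => x; rewrite bvecE; apply: eq_bigr => l _; rewrite mxE bvecE.
Qed.

Lemma sum_cflux_bmx m (k : 'I_m -> R) (fe ge : 'I_nE -> 'I_m -> C)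
    (f0 f1 g0 g1 : 'I_nI -> 'I_m -> C) :
  \sum_r cflux k (bmx fe f0 f1 r) (bmx ge g0 g1 r) =
  \sum_e cflux k (fe e) (ge e) +
  \sum_i (cflux k (f0 i) (g0 i) + cflux k (f1 i) (g1 i)).
Proof.
rewrite !big_split_ord /= big_split /= addrA.
by congr (_ + _ + _); apply: eq_bigr => x _;
  congr cflux; apply/funext => j; rewrite mxE bvecE.
Qed.

Hypotheses (a_gt0 : forall i, 0 < a i) (AB : maxiso A B).

(* The sum of the increments of the fluxes over all edges is minus the boundary
   form, while each of them is nonnegative. *)
Lemma exp_combination_eq0 m (k : 'I_m -> R) (beE : 'I_nE -> 'I_m -> C)
    (alI beI : 'I_nI -> 'I_m -> C) :
  (forall j, 0 < k j) -> injective k ->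
  let y1 := bmx (fun e j => cexp 0 (beE e j) (k j) 0)
    (fun i j => cexp (alI i j) (beI i j) (k j) 0)
    (fun i j => cexp (alI i j) (beI i j) (k j) (a i)) in
  let y2 := bmx (fun e j => dcexp 0 (beE e j) (k j) 0)
    (fun i j => dcexp (alI i j) (beI i j) (k j) 0)
    (fun i j => - dcexp (alI i j) (beI i j) (k j) (a i)) in
  A *m y1 + B *m y2 = 0 -> 0 <= \sum_j \sum_l (adjmx y1 *m y2) j l ->
  (forall e j, beE e j = 0) /\ (forall i j, alI i j = 0 /\ beI i j = 0).
Proof.
move=> k_gt0 k_inj y1 y2 y12.
have iso := maxiso_isotropic AB y12.
rewrite -(sum_cflux k iso) sum_cflux_bmx lecE => /andP[_] /=.
rewrite ReD !Re_sum.
set Fe := fun e => complex.Re (cflux k (fun j => cexp 0 (beE e j) (k j) 0)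
   (fun j => dcexp 0 (beE e j) (k j) 0)).
set F := fun i x => complex.Re (cflux k (fun j => cexp (alI i j) (beI i j) (k j) x)
   (fun j => dcexp (alI i j) (beI i j) (k j) x)).
(* The inward derivative at [a i] carries a minus sign, which turns the two endpoint contributions
   into minus the increment. *)
rewrite -/Fe (eq_bigr (fun i => F i 0 - F i (a i))) => [|i _]; last first.
  by rewrite ReD cfluxN ReN.
move=> S0.
have Fe0 e : Fe e <= 0 := proj1 (cflux_external k_gt0 k_inj (beE e)).
have F0 i : F i 0 - F i (a i) <= 0.
  by rewrite subr_le0; exact: proj1 (cflux_internal k_gt0 k_inj (alI i) (beI i) (a_gt0 i)).
have SFe : \sum_e Fe e <= 0 by apply: sumr_le0.
have SF : \sum_i (F i 0 - F i (a i)) <= 0 by apply: sumr_le0.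
have z1 : \sum_e - Fe e = 0 by rewrite sumrN; lra.
have z2 : \sum_i - (F i 0 - F i (a i)) = 0 by rewrite sumrN; lra.
split=> [e|i].
  apply: (proj2 (cflux_external k_gt0 k_inj (beE e))); rewrite -/(Fe e).
  move/eqP: z1; rewrite psumr_eq0 => [/allP/(_ e (mem_index_enum _))|e' _].
    by rewrite /= oppr_eq0 => /eqP ->.
  by rewrite oppr_ge0.
apply: (proj2 (cflux_internal k_gt0 k_inj (alI i) (beI i) (a_gt0 i))).
rewrite -/(F i 0) -/(F i (a i)).
move/eqP: z2; rewrite psumr_eq0 => [/allP/(_ i (mem_index_enum _))|i' _].
  by rewrite /= oppr_eq0 subr_eq0 => /eqP ->.
by rewrite oppr_ge0.
Qed.

(** Square integrability removes the growing exponential on external edges, whence the coefficient 0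
    there. All other coefficients are packed into one [p], so that a single choice selects them for
    a whole family of eigenfunctions. *)
Lemma eigfun_exp (lam k : R) (psiE : 'I_nE -> R -> C) (psiI : 'I_nI -> R -> C) :
  0 < k -> k ^+ 2 = - lam -> eigfun a A B lam psiE psiI ->
  exists (p : ('I_nE -> C) * (('I_nI -> C) * ('I_nI -> C))),
  [/\ forall e x, @IE R x -> psiE e x = cexp 0 (p.1 e) k x,
      forall i x, II (a i) x -> psiI i x = cexp (p.2.1 i) (p.2.2 i) k x &
      A *m bvec (fun e => cexp 0 (p.1 e) k 0) (fun i => cexp (p.2.1 i) (p.2.2 i) k 0)
        (fun i => cexp (p.2.1 i) (p.2.2 i) k (a i)) +
      B *m bvec (fun e => dcexp 0 (p.1 e) k 0) (fun i => dcexp (p.2.1 i) (p.2.2 i) k 0)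
        (fun i => - dcexp (p.2.1 i) (p.2.2 i) k (a i)) = 0].
Proof.
move=> k0 k2 [dE [ddE [dI [ddI [inE [inI [bc [aeE aeI]]]]]]]].
have IE0 : @IE R 0 by rewrite /IE /= in_itv /= lexx.
have II0 i : II (a i) 0 by rewrite /II /= in_itv /= lexx ltW.
have IIa i : II (a i) (a i) by rewrite /II /= in_itv /= lexx ltW.
have subE x : @IE R x -> 0 <= x /\ `[0, x]%classic `<=` @IE R.
  rewrite /IE /= in_itv /= andbT => x0; split=> // y /=.
  by rewrite !in_itv /= => /andP[->].
have subI i x : II (a i) x -> 0 <= x /\ `[0, x]%classic `<=` II (a i).
  rewrite /II /= in_itv /= => /andP[x0 xa]; split=> // y /=.
  by rewrite !in_itv /= => /andP[-> /le_trans]; apply.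
have HE e : exists be, forall x, @IE R x ->
    psiE e x = cexp 0 be k x /\ dE e x = dcexp 0 be k x.
  have [p1 [p2 [fL2 _]]] := inE e.
  have := aeE e; rewrite -k2 => ae.
  have [al [be H]] := eigen_edge (lt0r_neq0 k0) IE0 subE p1 p2 ae.
  exists be; suff <- : al = 0 by [].
  by apply: (L2_cexp k0 fL2 (be := be)) => x /H[].
have HI i : exists q : C * C, forall x, II (a i) x ->
    psiI i x = cexp q.1 q.2 k x /\ dI i x = dcexp q.1 q.2 k x.
  have [p1 [p2 _]] := inI i; have := aeI i; rewrite -k2 => ae.
  by have [al [be H]] := eigen_edge (lt0r_neq0 k0) (II0 i) (subI i) p1 p2 ae; exists (al, be).
have [be Hbe] := choice HE; have [q Hq] := choice HI.
exists (be, (fun i => (q i).1, fun i => (q i).2)); split=> /=.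
- by move=> e x /(Hbe e)[].
- by move=> i x /(Hq i)[].
rewrite -[RHS]bc; congr (_ + _); congr (_ *m _); congr bvec; apply/funext => i.
- by have [-> _] := Hbe i 0 IE0.
- by have [-> _] := Hq i 0 (II0 i).
- by have [-> _] := Hq i _ (IIa i).
- by have [_ ->] := Hbe i 0 IE0.
- by have [_ ->] := Hq i 0 (II0 i).
- by have [_ ->] := Hq i _ (IIa i).
Qed.

End graph.

(** * Upper bound *)

(** Column [j] of [E] is supported on the functions with exponent [k j]. Merging these into one
    matters because the flux weights require distinct exponents. *)
Lemma cexp_sum (R : realType) (N m : nat) (al be : 'I_N -> R[i]) (k : 'I_m -> R)
    (tg : 'I_N -> 'I_m) (E : 'M[R[i]]_(N, m)) (x : R) (j : 'I_m) :
  (forall l, tg l != j -> E l j = 0) ->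
  \sum_l cexp (al l) (be l) (k (tg l)) x * E l j =
  cexp (\sum_l al l * E l j) (\sum_l be l * E l j) (k j) x.
Proof.
move=> E0; rewrite /cexp !mulr_suml -big_split; apply: eq_bigr => l _ /=.
have [->|/E0 ->] := eqVneq (tg l) j; last by rewrite !mulr0 !mul0r addr0.
by ring.
Qed.

Lemma dcexp_sum (R : realType) (N m : nat) (al be : 'I_N -> R[i]) (k : 'I_m -> R)
    (tg : 'I_N -> 'I_m) (E : 'M[R[i]]_(N, m)) (x : R) (j : 'I_m) :
  (forall l, tg l != j -> E l j = 0) ->
  \sum_l dcexp (al l) (be l) (k (tg l)) x * E l j =
  dcexp (\sum_l al l * E l j) (\sum_l be l * E l j) (k j) x.
Proof.
move=> E0; rewrite /dcexp !mulr_suml -sumrB; apply: eq_bigr => l _ /=.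
have [->|/E0 ->] := eqVneq (tg l) j; last by rewrite !mulr0 !mul0r subrr.
by ring.
Qed.

Lemma form_const_mx (R : realType) n m (y1 y2 : 'M[R[i]]_(n, m)) :
  (adjmx (y1 *m const_mx 1) *m (y2 *m const_mx 1) : 'M[R[i]]_1) 0 0 =
  \sum_j \sum_l (adjmx y1 *m y2) j l.
Proof.
rewrite adjmxM -!mulmxA (mulmxA (adjmx y1)).
set Y := adjmx y1 *m y2; clearbody Y.
rewrite mxE; apply: eq_bigr => j _; rewrite !mxE conjC1 mul1r.
by apply: eq_bigr => l _; rewrite mxE mulr1.
Qed.

Lemma negative_sqrt (R : realType) (m : nat) (lam : 'I_m -> R) :
  injective lam -> (forall j, lam j < 0) ->
  exists k : 'I_m -> R,
  [/\ forall j, 0 < k j, injective k & forall j, k j ^+ 2 = - lam j].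
Proof.
move=> lam_inj lam0; exists (fun j => Num.sqrt (- lam j)).
have k2 j : Num.sqrt (- lam j) ^+ 2 = - lam j by rewrite sqr_sqrtr // oppr_ge0 ltW.
split=> // [j|i j ij]; first by rewrite sqrtr_gt0 oppr_gt0.
by apply/lam_inj/oppr_inj; rewrite -[LHS]k2 -[RHS]k2 ij.
Qed.

Lemma neg_count_le_n_plus (R : realType) (nE nI : nat) (a : 'I_nI -> R)
    (A B : 'M[R[i]]_(nE + nI + nI)) (k : nat) :
  (forall i, 0 < a i) -> maxiso A B -> n_plus (A *m adjmx B) k ->
  neg_count_le a A B k.
Proof.
move=> a0 AB ABk m lam d [lam_inj [lam0 mult]]; rewrite leqNgt; apply/negP => kN.
have [kap [kap0 kap_inj kap2]] := negative_sqrt lam_inj lam0.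
pose pE j := projT1 (cid (mult j)).
pose pI j := projT1 (cid (projT2 (cid (mult j)))).
have [eig indep] : (forall j s, eigfun a A B (lam j) (pE j s) (pI j s)) /\
    (forall j (c : 'I_(d j) -> R[i]),
    (forall e x, @IE R x -> \sum_s c s * pE j s e x = 0) ->
    (forall i x, II (a i) x -> \sum_s c s * pI j s i x = 0) -> forall s, c s = 0).
  by split=> j; have [] := projT2 (cid (projT2 (cid (mult j)))).
(* All eigenfunctions are listed together, indexed by an eigenvalue and a position within its
   independent family; [tg] recovers the eigenvalue. *)
pose T := {j : 'I_m & 'I_(d j)}.
have cardT : #|{: T}| = (\sum_j d j)%N.
  rewrite card_tagged sumnE big_map big_enum /=.
  by apply: eq_bigr => j _; rewrite card_ord.
rewrite -cardT in kN; pose N := #|{: T}|.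
pose tg (l : 'I_N) := tag (enum_val l).
have /choice[p Hp] : forall l : 'I_N, exists q, _ := fun l =>
  eigfun_exp a0 (kap0 (tg l)) (kap2 (tg l)) (eig (tg l) (tagged (enum_val l))).
pose X1 : 'M[R[i]]_(nE + nI + nI, N) := bmx
  (fun e l => cexp 0 ((p l).1 e) (kap (tg l)) 0)
  (fun i l => cexp ((p l).2.1 i) ((p l).2.2 i) (kap (tg l)) 0)
  (fun i l => cexp ((p l).2.1 i) ((p l).2.2 i) (kap (tg l)) (a i)).
pose X2 : 'M[R[i]]_(nE + nI + nI, N) := bmx
  (fun e l => dcexp 0 ((p l).1 e) (kap (tg l)) 0)
  (fun i l => dcexp ((p l).2.1 i) ((p l).2.2 i) (kap (tg l)) 0)
  (fun i l => - dcexp ((p l).2.1 i) ((p l).2.2 i) (kap (tg l)) (a i)).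
have X12 : A *m X1 + B *m X2 = 0.
  apply/matrixP => r l; have [_ _ bc] := Hp l.
  have : col l (A *m X1 + B *m X2) = 0.
    by rewrite -[RHS]bc colE mulmxDl -!mulmxA -!colE /X1 /X2 !col_bmx.
  by move=> /colP /(_ r); rewrite mxE => ->; rewrite !mxE.
have [c c0 cge] := maxiso_nonneg AB ABk X12 kN.
(* Splits [c] by eigenvalue: column [j] keeps its part belonging to [lam j], and the columns add up
   to [c]. The form at [c] thus becomes the sum of all entries of the form on the merged
   functions. *)
pose E : 'M[R[i]]_(N, m) := \matrix_(l, j) (if tg l == j then c l 0 else 0).
have E0 j l : tg l != j -> E l j = 0 by rewrite mxE => /negPf ->.
have Y1E : X1 *m E = bmx (fun e j => cexp 0 (\sum_l (p l).1 e * E l j) (kap j) 0)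
  (fun i j => cexp (\sum_l (p l).2.1 i * E l j) (\sum_l (p l).2.2 i * E l j) (kap j) 0)
  (fun i j => cexp (\sum_l (p l).2.1 i * E l j) (\sum_l (p l).2.2 i * E l j) (kap j) (a i)).
  rewrite /X1 mul_bmx; congr bmx; apply/funext => e; apply/funext => j;
    rewrite (cexp_sum _ _ _ _ (E0 j)) //.
  by congr cexp; rewrite big1 // => l _; rewrite mul0r.
have Y2E : X2 *m E = bmx (fun e j => dcexp 0 (\sum_l (p l).1 e * E l j) (kap j) 0)
  (fun i j => dcexp (\sum_l (p l).2.1 i * E l j) (\sum_l (p l).2.2 i * E l j) (kap j) 0)
  (fun i j => - dcexp (\sum_l (p l).2.1 i * E l j) (\sum_l (p l).2.2 i * E l j) (kap j) (a i)).
  rewrite /X2 mul_bmx; congr bmx; apply/funext => e; apply/funext => j;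
    rewrite -?(dcexp_sum _ _ _ _ (E0 j)) //.
  - rewrite (dcexp_sum _ _ _ _ (E0 j)); congr dcexp.
    by rewrite big1 // => l _; rewrite mul0r.
  - by rewrite -sumrN; apply: eq_bigr => l _; rewrite mulNr.
have Ec : E *m const_mx 1 = c :> 'cV_N.
  apply/colP => l; rewrite mxE (bigD1 (tg l)) //= big1 => [|j lj].
    by rewrite addr0 !mxE eqxx mulr1.
  by rewrite E0 ?mul0r // eq_sym.
have [] := exp_combination_eq0 a0 AB (beE := fun e j => \sum_l (p l).1 e * E l j)
  (alI := fun i j => \sum_l (p l).2.1 i * E l j)
  (beI := fun i j => \sum_l (p l).2.2 i * E l j) kap0 kap_inj.
- by rewrite -Y1E -Y2E !mulmxA -mulmxDl X12 mul0mx.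
- by rewrite -Y1E -Y2E -form_const_mx -!mulmxA Ec.
move=> bE0 I0; case/negP: c0; apply/eqP/colP => l; rewrite [RHS]mxE.
have sumE j (f : forall i, 'I_(d i) -> R[i]) :
    \sum_s c (enum_rank (Tagged (fun i => 'I_(d i)) (s : 'I_(d j)))) 0 * f j s =
    \sum_l f (tg l) (tagged (enum_val l)) * E l j.
  rewrite (reindex _ (onW_bij _ (@enum_rank_bij T))) /=.
  pose G i (s : 'I_(d i)) :=
    f i s * (if i == j then c (enum_rank (Tagged (fun i => 'I_(d i)) s)) 0 else 0).
  transitivity (\sum_i \sum_s G i s); last first.
    rewrite sig_big_dep; apply: eq_bigr => -[i s] _.
    by rewrite mxE /tg enum_rankK.
  rewrite /G.
  rewrite (bigD1 j) //= [X in _ + X]big1 ?addr0 => [|i /negPf ->].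
    by apply: eq_bigr => s _; rewrite eqxx mulrC.
  by rewrite big1 // => s _; rewrite mulr0.
(* The merged function of each eigenvalue has zero coefficients, so independence within that family
   forces [c] to vanish. *)
have := indep (tg l) (fun s => c (enum_rank (Tagged (fun i => 'I_(d i)) s)) 0) _ _
  (tagged (enum_val l)).
have -> : Tagged (fun i => 'I_(d i)) (tagged (enum_val l)) = enum_val l.
  by case: (enum_val l).
rewrite enum_valK; apply=> [e x xE|i x xi].
  rewrite (sumE (tg l) (fun j s => pE j s e x)).
  under eq_bigr => l' _ do rewrite (let: And3 h _ _ := Hp l' in h e x xE).
  rewrite (cexp_sum _ _ _ _ (E0 _)) bE0 big1 => [|? _]; last by rewrite mul0r.
  by rewrite /cexp !mul0r addr0.
rewrite (sumE (tg l) (fun j s => pI j s i x)).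
under eq_bigr => l' _ do rewrite (let: And3 _ h _ := Hp l' in h i x xi).
rewrite (cexp_sum _ _ _ _ (E0 _)); have [-> ->] := I0 i (tg l).
by rewrite /cexp !mul0r addr0.
Qed.

(** * Exact count without internal edges *)

Lemma is_derive_is_primR (R : realType) (I : set R) (f g : R -> R) :
  (forall x, I x -> 0 <= x) -> (forall x : R, is_derive x 1 f (g x)) ->
  continuous g -> is_primR I f g.
Proof.
move=> I0 fg cg x /I0.
have gi : (@lebesgue_measure R).-integrable `[0, x]%classic (fun t => (g t)%:E).
  apply: continuous_compact_integrable; first exact: segment_compact.
  exact: continuous_subspaceT.
rewrite le_eqVlt => /predU1P[x0|x0]; split=> //.
  by rewrite -x0 set_itv1 Rintegral_set1 addr0.
have cf y : {for y, continuous f}.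
  by apply/differentiable_continuous/derivable1_diffP; have [] := fg y.
rewrite /Rintegral (@continuous_FTC2 _ g f 0 x x0) /=.
- by ring.
- exact: continuous_subspaceT.
- split; first by move=> y _; have [] := fg y.
  + exact/cvg_at_right_filter/cf.
  + exact/cvg_at_left_filter/cf.
- by move=> y _; rewrite derive1E; have [_ ->] := fg y.
Qed.

Lemma integrable_expRN (R : realType) (k : R) : 0 < k ->
  (@lebesgue_measure R).-integrable (@IE R) (fun x => (expR (- k * x))%:E).
Proof.
move=> k0; apply/integrableP; split.
  have cf : {within @IE R, continuous (fun x : R => expR (- k * x))}.
    by apply: continuous_subspaceT => x; exact: continuous_expRM.
  have := subspace_continuous_measurable_fun (measurable_itv _) cf.
  by move=> mf; apply: measurableT_comp mf.
rewrite [X in (X < _)%E](_ : _ =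
    \int[@lebesgue_measure R]_(x in @IE R) (expR (- k * x))%:E)%E; last first.
  by apply: eq_integral => x _; rewrite gee0_abs ?lee_fin ?expR_ge0.
pose F x := - k^-1 * expR (- k * x).
have dF (x : R) : is_derive x 1 F (expR (- k * x)).
  have := is_deriveZ (- k^-1) (is_derive_expRM (- k) x).
  move=> /is_derive_eq; apply; rewrite /GRing.scale /= mulrA mulNr mulrN opprK.
  by rewrite mulVf ?mul1r // gt_eqF.
rewrite /IE (@ge0_continuous_FTC2y _ _ F 0 0) ?ltry //.
- by apply: continuous_subspaceT => x; exact: continuous_expRM.
- apply: cvgy_mul0; under eq_fun do rewrite mulNr.
  apply: (cvg_comp _ _ _ (@cvgr_expR R)).
  exact: (gt0_cvgMry k0 cvg_id).
- apply: cvg_at_right_filter; apply/differentiable_continuous/derivable1_diffP.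
  by have [] := dF 0.
- by move=> x _; rewrite derive1E; have [_ ->] := dF x.
Qed.

Lemma L2_decay (R : realType) (k : R) (c : R[i]) : 0 < k ->
  L2 (@IE R) (fun x => c * (expR (- k * x))%:C).
Proof.
move=> k0; have k20 : 0 < 2 * k by rewrite mulr_gt0.
suff : (@lebesgue_measure R).-integrable (@IE R)
    (fun x => ((normsq c)%:E * (expR (- (2 * k) * x))%:E)%E).
  apply: eq_integrable => [|x _]; first exact: measurable_itv.
  rewrite -EFinM /normsq Re_mulrc Im_mulrc; congr EFin.
  rewrite (_ : - (2 * k) * x = - k * x + - k * x); last by ring.
  by rewrite expRD; ring.
apply: integrableZl; first exact: measurable_itv.
exact: integrable_expRN.
Qed.

Lemma cexp0_0 (R : realType) (c : R[i]) (k : R) : cexp 0 c k 0 = c.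
Proof. by rewrite /cexp !mulr0 expR0 mul0r add0r (mulr1 c). Qed.

Lemma dcexp0_0 (R : realType) (c : R[i]) (k : R) : dcexp 0 c k 0 = - k%:C * c.
Proof. by rewrite /dcexp !mulr0 expR0 !mul0r sub0r (mulr1 (c * k%:C)) mulNr mulrC. Qed.

Lemma in_D_decay (R : realType) (k : R) (c : R[i]) : 0 < k ->
  in_D (@IE R) (cexp 0 c k) (dcexp 0 c k) (fun x => (k ^+ 2)%:C * cexp 0 c k x).
Proof.
move=> k0.
have I0 x : @IE R x -> 0 <= x by rewrite /IE /= in_itv /= andbT.
have cexpE x : cexp 0 c k x = c * (expR (- k * x))%:C.
  by rewrite /cexp mul0r add0r.
(* A family with a single index lets the derivative formulas for [exp_sol] be reused on the real and
   imaginary parts. *)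
have D al be (x : R) := is_derive_exp_sol (fun _ : 'I_1 => k) (fun=> al) (fun=> be) ord0 x.
have DD al be (x : R) := is_derive_dexp_sol (fun _ : 'I_1 => k) (fun=> al) (fun=> be) ord0 x.
have contS al be : continuous (exp_sol (fun _ : 'I_1 => k) (fun=> al) (fun=> be) ord0).
  by move=> x; apply/differentiable_continuous/derivable1_diffP; have [] := D al be x.
have contD al be : continuous (dexp_sol (fun _ : 'I_1 => k) (fun=> al) (fun=> be) ord0).
  by move=> x; apply/differentiable_continuous/derivable1_diffP; have [] := DD al be x.
have contS2 al be : continuous
    (fun x => k ^+ 2 * exp_sol (fun _ : 'I_1 => k) (fun=> al) (fun=> be) ord0 x).
  by move=> x; apply: cvgM; [exact: cvg_cst|exact: contS].
have eqP1 (f g p q : R -> R) : is_primR (@IE R) p q ->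
    (forall x, f x = p x) -> (forall x, g x = q x) -> is_primR (@IE R) f g.
  by move=> pq /funext -> /funext ->.
split; last split; last split.
- split; apply: eqP1 (is_derive_is_primR I0 (D _ _) (contD _ _)) _ _ => x;
    by rewrite ?Re_cexp ?Im_cexp ?Re_dcexp ?Im_dcexp.
- split; apply: eqP1 (is_derive_is_primR I0 (DD _ _) (contS2 _ _)) _ _ => x;
    by rewrite ?Re_dcexp ?Im_dcexp // mulrC ?Re_mulrc ?Im_mulrc mulrC ?Re_cexp ?Im_cexp.
- rewrite (_ : cexp 0 c k = (fun x => c * (expR (- k * x))%:C)); last exact/funext.
  exact: L2_decay.
- rewrite (_ : (fun _ => _) = (fun x => (k ^+ 2)%:C * c * (expR (- k * x))%:C)).
    exact: L2_decay.
  by apply/funext => x; rewrite cexpE mulrA.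
Qed.

Lemma count_eq_n_plus (R : realType) (nE nI : nat) (a : 'I_nI -> R)
    (A B : 'M[R[i]]_(nE + nI + nI)) (k : nat) :
  nI = 0%N -> maxiso A B -> n_plus (A *m adjmx B) k ->
  exists m (lam : 'I_m -> R) (d : 'I_m -> nat),
    neg_eig_config a A B lam d /\ (\sum_(j < m) d j)%N = k.
Proof.
move=> nI0 AB ABk; have [V [kap [f [Vu f_inj kap0 pencil]]]] := maxiso_pencil AB ABk.
have noI : 'I_nI -> False by case=> i; rewrite nI0.
(* Eigenvalues of a configuration are distinct, so repeated values of [kap] are merged; the
   multiplicity is the size of the fibre [S j], and the fibres partition the [k] indices. *)
pose u := undup [seq kap l | l <- enum 'I_k]; pose um (j : 'I_(size u)) := nth 0 u j.
have um_in j : exists l, um j = kap l.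
  have : um j \in u by exact: mem_nth.
  by rewrite mem_undup => /mapP[l _ ->]; exists l.
have um0 j : 0 < um j by have [l ->] := um_in j.
pose S j := [pred l | kap l == um j].
exists (size u), (fun j => - um j ^+ 2), (fun j => #|S j|); split; last first.
  under eq_bigr => j _ do rewrite -sum1_card big_mkcond /=.
  rewrite exchange_big /= -[RHS]card_ord -sum1_card; apply: eq_bigr => l _.
  have lu : (index (kap l) u < size u)%N.
    by rewrite index_mem mem_undup map_f // mem_enum.
  rewrite -big_mkcond /= (big_pred1 (Ordinal lu)) // => j; rewrite !inE /um.
  apply/eqP/eqP => [e|->]; last by rewrite /= nth_index // -index_mem.
  by apply: val_inj; rewrite /= e index_uniq // undup_uniq.
split; [|split=> [j|j]].
- move=> j j' /oppr_inj /eqP; rewrite eqrXn2 // ?ltW // => /eqP.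
  by move/(uniqP 0 (undup_uniq _)) => jj; apply/val_inj/jj; rewrite inE.
- by rewrite oppr_lt0 exprn_gt0.
pose v (s : 'I_#|S j|) := f (enum_val s).
pose psi (s : 'I_#|S j|) (e : 'I_nE) := cexp 0 (V (lshift _ (lshift _ e)) (v s)) (um j).
exists psi, (fun _ _ _ => 0); split=> [s|c cE _ s].
  exists (fun e => dcexp 0 (V (lshift _ (lshift _ e)) (v s)) (um j)),
    (fun e x => (um j ^+ 2)%:C * psi s e x), (fun _ _ => 0), (fun _ _ => 0).
  split; [|split; [|split; [|split]]].
  - by move=> e; exact: in_D_decay.
  - by move=> i; case: (noI i).
  - have -> : bvec (fun e => psi s e 0) (fun=> 0) (fun=> 0) = col (v s) V.
      apply/colP => r; elim/forall_bindex: r => x; try by case: (noI x).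
      by rewrite bvecE mxE /psi cexp0_0.
    (* The decaying exponential has derivative [- um j] times its value at 0, so the boundary
       condition is exactly the pencil equation for this column. *)
    rewrite [X in B *m X](_ : _ = - (um j)%:C *: col (v s) V); last first.
      apply/colP => r; elim/forall_bindex: r => x; try by case: (noI x).
      by rewrite bvecE !mxE dcexp0_0.
    rewrite -scalemxAr pencil; have /eqP -> : kap (enum_val s) == um j by exact: (enum_valP s).
    by rewrite scaleNr subrr.
  - by move=> e; apply: aeW => x _; rewrite opprK.
  - by move=> i; case: (noI i).
(* Extends [c] by zero to all columns of [V]. Evaluating the vanishing combination at [x = 0] gives
   [V *m w = 0], and [V] is invertible. *)
pose w : 'cV[R[i]]_(nE + nI + nI) := \col_i \sum_s' (if i == v s' then c s' else 0).
have wE i : w i 0 = \sum_s' (if i == v s' then c s' else 0) by rewrite mxE.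
have Vw : V *m w = 0.
  apply/colP => r; elim/forall_bindex: r => x; try by case: (noI x).
  have := cE x 0; rewrite /IE /= in_itv /= lexx => /(_ isT) e; rewrite [RHS]mxE -[RHS]e.
  rewrite [LHS]mxE; under [LHS]eq_bigr => i _ do rewrite wE mulr_sumr.
  rewrite exchange_big /=; apply: eq_bigr => s' _.
  rewrite (bigD1 (v s')) //= eqxx big1 => [|i /negPf ->]; last by rewrite mulr0.
  by rewrite addr0 /psi cexp0_0 mulrC.
have : w (v s) 0 = 0 by rewrite -[w](mulKmx Vu) Vw mulmx0 mxE.
rewrite wE (bigD1 s) //= eqxx big1 ?addr0 // => s' ss'.
by rewrite (inj_eq f_inj) (inj_eq enum_val_inj) eq_sym (negPf ss').
Qed.

Theorem theorem3p7 (R : realType) (nE nI : nat) (a : 'I_nI -> R)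
  (A B : 'M[R[i]]_(nE + nI + nI)) (k : nat) :
  (forall i, 0 < a i) ->
  maxiso A B ->
  n_plus (A *m adjmx B) k ->
  neg_count_le a A B k /\ (nI = 0%N -> neg_count_eq a A B k).
Proof.
move=> a0 AB ABk; split=> [|nI0]; first exact: neg_count_le_n_plus.
split; [exact: neg_count_le_n_plus|exact: count_eq_n_plus].
Qed.
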